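(* Every infinite precompact group (in particular, every infinite precompact abelian group) admits an infinite quotient group with density at most $\mathfrak{c}$.
   Context: All topological groups are Hausdorff. A topological group $G$ is precompact if for every neighborhood $U$ of the identity there is a finite $F\subseteq G$ with $G=FU$. A quotient group of $G$ is $G/N$ with the quotient topology, where $N$ is a closed normal subgroup. The density of a space is the least cardinality of a dense subset. $\mathfrak{c}=2^\omega$. *)

(* Defs.v *)
From HB Require Import structures.
From mathcomp Require Import all_boot.
From mathcomp Require Import all_classical.
From mathcomp Require Import topology.

Set Implicit Arguments.
Unset Strict Implicit.
Unset Printing Implicit Defensive.

Local Open Scope classical_set_scope.
Local Open Scope card_scope.
Local Open Scope quotient_scope.
Local Open Scope group_scope.

HB.mixin Record isTopologicalGroup G of Group G & Topological G := {
  mulg_continuous : continuous (fun p : G * G => p.1 * p.2);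
  invg_continuous : continuous (fun x : G => x^-1)
}.

(* Separation is not part of the structure: the Hausdorff axiom is the
   hypothesis [hausdorff_space G]. *)
#[short(type="topologicalGroupType")]
HB.structure Definition TopologicalGroup :=
  {G of Group G & Topological G & isTopologicalGroup G}.

(* Not the library's [precompact], which means "has compact closure". *)
Definition precompact_group (G : topologicalGroupType) :=
  forall U : set G, nbhs (1 : G) U ->
    exists2 F : set G, finite_set F & [set x * y | x in F & y in U] = setT.

Record closedNormalSubgroup (G : topologicalGroupType) := ClosedNormalSubgroup {
  cns_set : set G;
  cns1 : cns_set 1;
  cnsM : forall x y, cns_set x -> cns_set y -> cns_set (x * y);
  cnsV : forall x, cns_set x -> cns_set x^-1;
  cnsJ : forall x y, cns_set x -> cns_set (x ^ y);
  cns_closed : closed cns_set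
}.

Section QuotientGroup.
Context {G : topologicalGroupType} (N : closedNormalSubgroup G).
Implicit Types x y z : G.

Definition coset_rel : rel G := fun x y => `[< cns_set N (x^-1 * y) >].

Lemma coset_rel_refl : reflexive coset_rel.
Proof. by move=> x; apply/asboolP; rewrite mulVg; exact: cns1. Qed.

Lemma coset_rel_sym : symmetric coset_rel.
Proof.
move=> x y; apply/asboolP/asboolP => /cnsV.
  by rewrite invgM invgK.
by rewrite invgM invgK.
Qed.

Lemma coset_rel_trans : transitive coset_rel.
Proof.
move=> y x z /asboolP xy /asboolP yz; apply/asboolP.
by have := cnsM xy yz; rewrite -mulgA mulVKg.
Qed.

Canonical coset_equiv :=
  EquivRel coset_rel coset_rel_refl coset_rel_sym coset_rel_trans.

Definition quotient_group := quotient_topology {eq_quot coset_equiv}.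
Local Notation Q := quotient_group.

HB.instance Definition _ := Topological.on Q.
HB.instance Definition _ := Quotient.on Q.

Lemma quotient_groupP x y : \pi_Q x = \pi_Q y <-> cns_set N (x^-1 * y).
Proof.
split=> [/(@eqmodP G coset_equiv)/asboolP //|xy].
by apply/(@eqmodP G coset_equiv)/asboolP.
Qed.

Definition quotient_one : Q := \pi_Q 1.
Definition quotient_inv (a : Q) : Q := \pi_Q (repr a)^-1.
Definition quotient_mul (a b : Q) : Q := \pi_Q (repr a * repr b).

Lemma quotient_piV x : quotient_inv (\pi_Q x) = \pi_Q x^-1.
Proof.
apply/quotient_groupP; rewrite invgK.
have /quotient_groupP h : \pi_Q (repr (\pi_Q x)) = \pi_Q x by rewrite reprK.
have := cnsJ x^-1 (cnsV h).
by rewrite invgM !invgK conjgE invgK !mulgA mulgV mul1g.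
Qed.

Lemma quotient_piM x y : quotient_mul (\pi_Q x) (\pi_Q y) = \pi_Q (x * y).
Proof.
apply/quotient_groupP; set x' := repr _; set y' := repr _.
have /quotient_groupP hx : \pi_Q x' = \pi_Q x by rewrite reprK.
have /quotient_groupP hy : \pi_Q y' = \pi_Q y by rewrite reprK.
have := cnsM (cnsJ y' hx) hy.
by rewrite conjgE invgM !mulgA mulgK.
Qed.

Lemma pi_surj (a : Q) : exists x, \pi_Q x = a.
Proof. by exists (repr a); rewrite reprK. Qed.

Lemma quotient_mulA : associative quotient_mul.
Proof.
move=> a b c.
have [[[x <-] [y <-]] [z <-]] := (pi_surj a, pi_surj b, pi_surj c).
rewrite (quotient_piM y z) (quotient_piM x y).
by rewrite (quotient_piM x) (quotient_piM _ z) mulgA.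
Qed.

Lemma quotient_mul1 : left_id quotient_one quotient_mul.
Proof. by move=> a; have [x <-] := pi_surj a; rewrite quotient_piM mul1g. Qed.

Lemma quotient_1mul : right_id quotient_one quotient_mul.
Proof. by move=> a; have [x <-] := pi_surj a; rewrite quotient_piM mulg1. Qed.

Lemma quotient_mulV : left_inverse quotient_one quotient_inv quotient_mul.
Proof. by move=> a; have [x <-] := pi_surj a; rewrite quotient_piV quotient_piM mulVg. Qed.

Lemma quotient_Vmul : right_inverse quotient_one quotient_inv quotient_mul.
Proof. by move=> a; have [x <-] := pi_surj a; rewrite quotient_piV quotient_piM mulgV. Qed.

HB.instance Definition _ := isGroup.Build Q quotient_mulA quotient_mul1
  quotient_1mul quotient_mulV quotient_Vmul.

Lemma pi_mulg x y : \pi_Q (x * y) = \pi_Q x * \pi_Q y.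
Proof. by rewrite -quotient_piM. Qed.

Lemma pi_invg x : \pi_Q x^-1 = (\pi_Q x)^-1.
Proof. by rewrite -quotient_piV. Qed.

Lemma mulg_continuousl y : continuous (fun x => x * y).
Proof.
move=> x; apply: (@continuous_comp _ _ _ (fun x => (x, y))
  (fun p : G * G => p.1 * p.2)); last exact: mulg_continuous.
by apply: cvg_pair => /=; [exact: cvg_id|exact: cvg_cst].
Qed.

Lemma quotient_group_openE (U : set Q) : open U = open (\pi_Q @^-1` U).
Proof. by []. Qed.

Lemma pi_group_continuous : continuous (\pi_Q : G -> Q).
Proof. by apply/continuousP => U; rewrite quotient_group_openE. Qed.

Lemma pi_group_open (U : set G) : open U -> open (\pi_Q @` U).
Proof.
move=> oU; rewrite quotient_group_openE.
rewrite (_ : _ @^-1` _ = \bigcup_(n in cns_set N) ((fun x => x * n) @^-1` U)).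
  apply: bigcup_open => n _; apply: open_comp => // x _.
  exact: mulg_continuousl.
apply/seteqP; split=> [x [u Uu /quotient_groupP ux]|x [n Nn Uxn]] /=.
  exists (u^-1 * x)^-1; first exact: cnsV.
  by rewrite /preimage /= invgM invgK mulVKg.
exists (x * n) => //; apply/quotient_groupP.
by rewrite invgM mulgVK; exact: cnsV.
Qed.

Lemma quotient_mulg_continuous : continuous (fun p : Q * Q => p.1 * p.2).
Proof.
move=> -[a b] W /=; rewrite -[a]reprK -[b]reprK -pi_mulg.
move=> /pi_group_continuous.
rewrite /nbhs/= => WW.
have [[A B] /= [nA nB] AB] := @mulg_continuous G (repr a, repr b) _ WW.
exists (\pi_Q @` A^°, \pi_Q @` B^°) => /=.
  split; apply: open_nbhs_nbhs; split.
  - exact/pi_group_open/open_interior.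
  - by exists (repr a).
  - exact/pi_group_open/open_interior.
  - by exists (repr b).
move=> [_ _] /= [[u Au <-] [v Bv <-]]; rewrite -pi_mulg.
by apply: (AB (u, v)); split; exact: interior_subset.
Qed.

Lemma quotient_invg_continuous : continuous (fun a : Q => a^-1).
Proof.
apply/continuousP => U; rewrite !quotient_group_openE => oU.
rewrite (_ : _ @^-1` _ = (fun x : G => x^-1) @^-1` (\pi_Q @^-1` U)).
  by move/continuousP: (@invg_continuous G); exact.
by apply/seteqP; split=> x; rewrite /preimage /= pi_invg.
Qed.

HB.instance Definition _ := isTopologicalGroup.Build Q
  quotient_mulg_continuous quotient_invg_continuous.

Lemma quotient_group_hausdorff : hausdorff_space Q.
Proof.
move=> a b; have [[x <-] [y <-]] := (pi_surj a, pi_surj b) => ab.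
apply: contrapT => /quotient_groupP Nxy.
have cont : continuous (fun p : G * G => p.1^-1 * p.2).
  move=> p; apply: (@continuous_comp _ _ _ (fun p : G * G => (p.1^-1, p.2))
    (fun p : G * G => p.1 * p.2)); last exact: mulg_continuous.
  apply: cvg_pair => /=; last exact: cvg_snd.
  by apply: continuous_comp; [exact: cvg_fst|exact: invg_continuous].
have nC : nbhs (x^-1 * y) (~` cns_set N).
  by apply: open_nbhs_nbhs; split => //; exact/closed_openC/cns_closed.
have [[A B] /= [nA nB] AB] := cont (x, y) _ nC.
have [||_ [[u Au <-] [v Bv /esym/quotient_groupP]]] :=
  ab (\pi_Q @` A^°) (\pi_Q @` B^°).
- apply: open_nbhs_nbhs; split; first exact/pi_group_open/open_interior.
  by exists x.
- apply: open_nbhs_nbhs; split; first exact/pi_group_open/open_interior.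
  by exists y.
- by apply: (AB (u, v)); split; exact: interior_subset.
Qed.

End QuotientGroup.

(* Any nonempty family of subsets of T has a member that injects into all the
   others, so that the least cardinal below is attained. *)
Lemma exists_least_card (T : Type) (P : set (set T)) : P !=set0 ->
  exists2 A, P A & forall B, P B -> A #<= B.
Proof.
move=> [A0 PA0].
pose R (S : set (set T -> T)) :=
  (forall f, S f -> forall A, P A -> A (f A)) /\
  (forall f g, S f -> S g -> forall A, P A -> f A = g A -> f = g).
have [F FR totF|S [[Sin Sinj] Smax]] := @Zorn_bigcup _ R.
  split=> [f [S FS Sf]|f g [S FS Sf] [S' FS' Sg] A PA fg].
    exact: (FR _ FS).1.
  have [SS'|S'S] := totF _ _ FS FS'.
    by apply: (FR _ FS').2 fg => //; exact: SS'.
  by apply: (FR _ FS).2 fg => //; exact: S'S.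
have [[A PA AS]|noA] :=
  pselect (exists2 A, P A & A `<=` [set f A | f in S]).
  exists A => // B PB.
  apply: (card_le_trans (subset_card_le AS)).
  apply: (card_le_trans (card_image_le _ _)).
  have /card_eqPle[_ SB] : [set f B | f in S] #= S.
    by apply: inj_card_eq => f g /set_mem Sf /set_mem Sg; exact: Sinj.
  by apply: (card_le_trans SB); apply: subset_card_le => _ [f /Sin fP <-]; exact: fP.
have new A : P A -> exists2 t, A t & forall f, S f -> f A <> t.
  move=> PA; apply: contrapT => nt; apply: noA; exists A => // t At.
  by apply: contrapT => nf; apply: nt; exists t => // f Sf ft; apply: nf; exists f.
have [t0 _ _] := new _ PA0.
have /boolp.choice[h hP] (A : set T) :
    exists t, P A -> A t /\ forall f, S f -> f A <> t.
  have [/new[t At tS]|nPA] := pselect (P A); first by exists t.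
  by exists t0.
exfalso; apply: (Smax (S `|` [set h])).
  split=> [f Sf|]; first by left.
  by move=> /(_ h (or_intror erefl)) Sh; exact: (hP _ PA0).2 Sh erefl.
split=> [f [/Sin//|->] A /hP[]//|f g [Sf|->] [Sg|->] A PA //].
- exact: Sinj PA.
- by move/((hP _ PA).2 _ Sf).
- by move/esym/((hP _ PA).2 _ Sg).
Qed.

Section Density.
Variable X : topologicalType.

Lemma dense_least_card : exists D : set X,
  dense D /\ forall E : set X, dense E -> D #<= E.
Proof.
have [|D dD lD] := @exists_least_card X [set D | dense D]; last by exists D.
by exists setT => O [x Ox] _; exists x.
Qed.

(* The library has no type of cardinals: the density of X is represented by a
   dense set of least cardinality, to be compared with [#<=] and [#=]. *)
Definition density : set X := projT1 (cid dense_least_card).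

Lemma density_dense : dense density.
Proof. exact: (projT2 (cid dense_least_card)).1. Qed.

Lemma density_le (E : set X) : dense E -> density #<= E.
Proof. exact: (projT2 (cid dense_least_card)).2. Qed.

End Density.
Arguments density : clear implicits.

(* 2 ^ omega *)
Definition continuum : set (nat -> bool) := setT.

(* Main.v *)
Require Import Defs.
From mathcomp Require Import finmap.
From mathcomp Require Import all_boot.
From mathcomp Require Import all_classical.
From mathcomp Require Import topology.

Local Open Scope classical_set_scope.
Local Open Scope card_scope.

(** The quotient can be found without completing the group, and its whole
    underlying set, not just a dense subset, has at most continuum many points.

    In a precompact group [G] every neighborhood [U] of [1] contains all the
    conjugates of some smaller neighborhood ([precompact_nbhs_conjg]): write
    [G = F B] with [F] finite and [B] small, and require [v ^ f] to be small
    for the finitely many [f] in [F].  Therefore, given countably many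
    neighborhoods [O n] of [1], there are neighborhoods [u n] of [1] such that
    [u n.+1] has its quotients [x^-1 * y] and its conjugates in
    [u n `&` O n].  The intersection [N] of the [u n] is a closed normal
    subgroup contained in every [O n].  Since [G] is covered by finitely many
    translates of each [u n], there is a countable set [D] with
    [G = D (u n)] for all [n]; a coset [x N] is determined by the set of pairs
    [(n, d)] such that [x] lies in [d (u n)], so that [G / N] has at most
    continuum many points ([small_quotient]).

    It remains to make [G / N] infinite.  Fix distinct points [x 0, x 1, ...]
    of [G] and let the [O n] be the complements of the points
    [(x i)^-1 * x j], [i <> j], which are neighborhoods of [1] because [G] is
    Hausdorff.  Then the [x i] are pairwise distinct modulo [N]. *)

Set Implicit Arguments.
Unset Strict Implicit.

Local Open Scope quotient_scope.
Local Open Scope group_scope.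

Section TopologicalGroup.
Context {G : topologicalGroupType}.
Implicit Types (x y : G) (U V : set G).

Lemma divg_continuous : continuous (fun p : G * G => p.1^-1 * p.2).
Proof.
move=> p; apply: (@continuous_comp _ _ _ (fun p : G * G => (p.1^-1, p.2))
  (fun p : G * G => p.1 * p.2)); last exact: mulg_continuous.
apply: cvg_pair => /=; last exact: cvg_snd.
by apply: continuous_comp; [exact: cvg_fst|exact: invg_continuous].
Qed.

Lemma divgr_continuous y : continuous (fun x => x^-1 * y).
Proof.
move=> x; apply: (@continuous_comp _ _ _ (fun x => (x, y))
  (fun p : G * G => p.1^-1 * p.2)); last exact: divg_continuous.
by apply: cvg_pair => /=; [exact: cvg_id|exact: cvg_cst].
Qed.

Lemma mulgr_continuous y : continuous (fun x => y * x).
Proof.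
move=> x; apply: (@continuous_comp _ _ _ (fun x => (y, x))
  (fun p : G * G => p.1 * p.2)); last exact: mulg_continuous.
by apply: cvg_pair => /=; [exact: cvg_cst|exact: cvg_id].
Qed.

Lemma conjg_continuous y : continuous (fun x => x ^ y).
Proof.
move=> x; apply: (@continuous_comp _ _ _ (fun x => x * y) (fun x => y^-1 * x)).
  exact: mulg_continuousl.
exact: mulgr_continuous.
Qed.

Lemma nbhs1_divg U : nbhs (1 : G) U ->
  exists2 V, nbhs (1 : G) V & forall x y, V x -> V y -> U (x^-1 * y).
Proof.
move=> nU; have nU' : nbhs ((1 : G)^-1 * 1) U by rewrite mulVg.
have [[A B] /= [nA nB] AB] := @divg_continuous (1, 1) _ nU'.
exists (A `&` B); first exact: filterI.
by move=> x y [Ax _] [_ By]; exact: (AB (x, y)).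
Qed.

(** This is where normality comes from: over all [y], the conjugates of a
    small enough neighborhood are uniformly small. *)
Lemma precompact_nbhs_conjg U : precompact_group G -> nbhs (1 : G) U ->
  exists2 V, nbhs (1 : G) V & forall x y, V x -> U (x ^ y).
Proof.
move=> pG /nbhs1_divg[A nA AU]; have [B nB BA] := nbhs1_divg nA.
have [_ /finite_fsetP[F ->] FB] := pG _ nB.
exists (\bigcap_(f in [set` F]) [set x | B (x ^ f)^-1]).
  apply: filter_bigI => // f _.
  have nB' : nbhs ((1 : G) ^ f)^-1 B by rewrite conj1g invg1.
  have nB'' := @invg_continuous G _ _ nB'.
  exact: (@conjg_continuous f _ _ nB'').
move=> x y Vx; have : [set: G] y by [].
rewrite -FB => -[f Ff [b Bb <-]].
(* (x ^ f) ^ b is the quotient of b and (x ^ f) * b, both of which are in A *)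
rewrite conjgM (conjgE (x ^ f)); apply: AU.
  by rewrite -[b]mul1g -[1]invg1; apply: BA => //; exact: nbhs_singleton.
by rewrite -[x ^ f]invgK; apply: BA => //; exact: Vx.
Qed.

Lemma precompact_nbhs_divg_conjg U : precompact_group G -> nbhs (1 : G) U ->
  exists V, [/\ nbhs (1 : G) V,
    forall x y, V x -> V y -> U (x^-1 * y) & forall x y, V x -> U (x ^ y)].
Proof.
move=> pG nU; have [V nV VU] := nbhs1_divg nU.
have [W nW WU] := precompact_nbhs_conjg pG nU.
exists (V `&` W); split; first exact: filterI.
  by move=> x y [Vx _] [Vy _]; exact: VU.
by move=> x y [_ Wx]; exact: WU.
Qed.

(** The points [d k] enumerate a union of finite sets, one for each [u n]. *)
Lemma precompact_countable_cover (u : nat -> set G) :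
  precompact_group G -> (forall n, nbhs (1 : G) (u n)) ->
  exists d : nat -> G, forall n x, exists k, u n ((d k)^-1 * x).
Proof.
move=> pG nu.
have /boolp.choice[F FP] n : exists F : set G,
    finite_set F /\ [set x * y | x in F & y in u n] = setT.
  by have [F finF Fu] := pG _ (nu n); exists F.
have cD : countable (\bigcup_n F n).
  by apply: bigcup_countable => // n _; exact/finite_set_countable/(FP n).1.
have coverD n x : exists2 a, (\bigcup_n F n) a & u n (a^-1 * x).
  have : [set: G] x by [].
  rewrite -(FP n).2 => -[a Fa [b ub <-]].
  by exists a; [exists n|rewrite mulKg].
have /pfcard_geP[D0|/unsquash d] := cD.
  by have [a] := coverD 0 1; rewrite D0.
exists d => n x; have [a Da ua] := coverD n x.
by have [k _ kE] : (d @` setT) a; [exact: surj|exists k; rewrite kE].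
Qed.

(** Sequences of neighborhoods of [1] that shrink fast enough for their
    intersection to be a normal subgroup.  The [u n] need not be open, nor
    decreasing by hypothesis: [u n.+1 `<=` u n] is [u_divg] at [x = 1]. *)
Section IntersectionSubgroup.
Variable u : nat -> set G.
Hypothesis nu : forall n, nbhs (1 : G) (u n).
Hypothesis u_divg : forall n x y, u n.+1 x -> u n.+1 y -> u n (x^-1 * y).
Hypothesis u_conjg : forall n x y, u n.+1 x -> u n (x ^ y).

Let N : set G := \bigcap_n u n.

Let N1 : N 1. Proof. by move=> n _; exact: nbhs_singleton. Qed.

Let N_divg x y : N x -> N y -> N (x^-1 * y).
Proof. by move=> Nx Ny n _; apply: u_divg; [exact: Nx|exact: Ny]. Qed.

Let NV x : N x -> N x^-1.
Proof. by move=> Nx; rewrite -[x^-1]mulg1; exact: N_divg. Qed.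

Let NM x y : N x -> N y -> N (x * y).
Proof. by move=> /NV Nx Ny; rewrite -[x]invgK; exact: N_divg. Qed.

Let NJ x y : N x -> N (x ^ y).
Proof. by move=> Nx n _; apply: u_conjg; exact: Nx. Qed.

Let N_closed : closed N.
Proof.
move=> y Ny n _.
have nu' : nbhs (y^-1 * y) (u n.+1) by rewrite mulVg.
have [z [Nz uzy]] := Ny _ (@divgr_continuous y _ _ nu').
rewrite -[y](mulVKg z) -{1}[z]invgK; apply: u_divg => //.
exact: NV.
Qed.

(** The intersection of the [u n], as a closed normal subgroup. *)
Definition bigcap_subgroup : closedNormalSubgroup G :=
  ClosedNormalSubgroup N1 NM NV NJ N_closed.

Lemma card_quotient_bigcap_subgroup : precompact_group G ->
  [set: quotient_group bigcap_subgroup] #<= continuum.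
Proof.
move=> pG; have [d dP] := precompact_countable_cover pG nu.
(* The coset a is coded by the set of (n, k) such that its representative is in
   d k (u n), a subset of nat through [pickle]; integers that encode no pair
   are left out. *)
pose code (a : quotient_group bigcap_subgroup) (m : nat) : bool :=
  if unpickle m is Some (n, k) then `[< u n ((d k)^-1 * repr a) >] else false.
have code_inj : injective code.
  move=> a b ab; rewrite -[a]reprK -[b]reprK; apply/quotient_groupP => n _.
  have [k ka] := dP n.+1 (repr a).
  have kb : u n.+1 ((d k)^-1 * repr b).
    have := congr1 (@^~ (pickle (n.+1, k))) ab.
    by rewrite /code pickleK (asboolT ka) => /esym/asboolP.
  by have := u_divg ka kb; rewrite invgM invgK mulgA mulgK.
have /card_eqPle[_ le_code] :
    code @` [set: quotient_group bigcap_subgroup] #=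
    [set: quotient_group bigcap_subgroup].
  by apply: inj_card_eq => a b _ _; exact: code_inj.
by apply: (card_le_trans le_code); exact: subset_card_le.
Qed.

End IntersectionSubgroup.

(** Any countably many neighborhoods of [1] have a common closed normal subgroup
    whose quotient has at most continuum many points. *)
Lemma small_quotient (O : nat -> set G) :
  precompact_group G -> (forall n, nbhs (1 : G) (O n)) ->
  exists2 N : closedNormalSubgroup G, (forall n, cns_set N `<=` O n) &
    [set: quotient_group N] #<= continuum.
Proof.
move=> pG nO.
have /boolp.choice[V VP] U : exists V, nbhs (1 : G) U ->
    [/\ nbhs (1 : G) V, forall x y, V x -> V y -> U (x^-1 * y) &
        forall x y, V x -> U (x ^ y)].
  have [nU|] := pselect (nbhs (1 : G) U); last by exists U.
  by have [V VP] := precompact_nbhs_divg_conjg pG nU; exists V.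
(* [V] is applied to [u m `&` O m] so that the intersection is in each [O m]. *)
pose u := fix u n := if n is m.+1 then V (u m `&` O m) else setT.
have nuO n : nbhs (1 : G) (u n `&` O n).
  apply: filterI => //; elim: n => [|n IHn]; first exact: filterT.
  by have [] := VP _ (filterI IHn (nO n)).
have nu n : nbhs (1 : G) (u n).
  by apply: filterS (nuO n); exact: subIsetl.
have u_divg n x y : u n.+1 x -> u n.+1 y -> u n (x^-1 * y).
  by have [_ uV _] := VP _ (nuO n) => ux uy; have [] := uV x y ux uy.
have u_conjg n x y : u n.+1 x -> u n (x ^ y).
  by have [_ _ uJ] := VP _ (nuO n) => ux; have [] := uJ x y ux.
exists (bigcap_subgroup nu u_divg u_conjg).
  move=> n x /(_ n.+1 I) ux; have [_ _ uJ] := VP _ (nuO n).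
  by have [_] := uJ x 1 ux; rewrite conjg1.
exact: card_quotient_bigcap_subgroup.
Qed.

End TopologicalGroup.

Unset Implicit Arguments.
Set Strict Implicit.

Theorem proposition1p1 (G : topologicalGroupType)
    (hausdorffG : hausdorff_space G)
    (infiniteG : infinite_set [set: G])
    (precompactG : precompact_group G) :
  exists N : closedNormalSubgroup G,
    infinite_set [set: quotient_group N] /\
    density (quotient_group N) #<= continuum.
Proof.
have /infiniteP/card_leP/unsquash f := infiniteG.
pose x i := \val (f (to_setT i)).
have x_inj : injective x.
  move=> i j /val_inj fij.
  by have /(congr1 val) := @inj _ _ _ f _ _ (in_setT _) (in_setT _) fij.
(* [O m] excludes the quotient of the m-th pair of distinct points. *)
pose O m := if unpickle m is Some (i, j) then
  [set z : G | i <> j -> z <> (x i)^-1 * x j] else setT.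
have nO m : nbhs (1 : G) (O m).
  rewrite /O; case: unpickle => [[i j]|]; last exact: filterT.
  have [->|ij] := pselect (i = j); first by apply: filterE => z /(_ erefl).
  have xij : (1 : G) <> (x i)^-1 * x j.
    by move/(congr1 (fun z => x i * z)); rewrite mulg1 mulVKg => /x_inj.
  have op : open (~` [set (x i)^-1 * x j]).
    by apply/closed_openC/accessible_closed_set1/hausdorff_accessible.
  by apply: filterS (open_nbhs_nbhs (conj op xij)) => z zx _.
have [N NO cardN] := small_quotient precompactG nO; exists N; split.
  apply/infiniteP.
  pose y i : quotient_group N := \pi_(quotient_group N) (x i).
  have y_inj : injective y.
    move=> i j /quotient_groupP /(NO (pickle (i, j))); rewrite /O pickleK /=.
    by move=> ij; apply: contrapT => /ij.
  have /card_eqPle[_ le_y] : y @` [set: nat] #= [set: nat].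
    by apply: inj_card_eq => i j _ _; exact: y_inj.
  by apply: (card_le_trans le_y); exact: subset_card_le.
have dT : dense [set: quotient_group N].
  by move=> U [a Ua] _; exists a.
exact: card_le_trans (density_le dT) cardN.
Qed.
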